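(* Let $V$ be a capacity on $(\Omega,\mathcal F)$, let $\varphi_1,\varphi_2:\mathbb R\to\mathbb R$ be bounded Borel measurable functions, and let $\hat f:\mathbb R^2\to\mathbb R$, $\hat f(x_1,x_2)=e^{\varphi_1(x_1)+\varphi_2(x_2)}$. If $X_1$ and $X_2$ are real random variables on $(\Omega,\mathcal F)$ that are Fubini independent for $\mathcal U_{\hat f}$, then $$E_V[\hat f(X_1,X_2)]=E_V\big[E_V[\hat f(x_1,X_2)]|_{x_1=X_1}\big].$$
   Context: $(\Omega,\mathcal F)$ is a measurable space. A capacity is a set function $V:\mathcal F\to[0,1]$ with $V(\emptyset)=0$, $V(\Omega)=1$, and $V(A)\le V(B)$ whenever $A\subseteq B$, $A,B\in\mathcal F$. A random variable is an $\mathcal F$-measurable map $\Omega\to\mathbb R$. The Choquet integral of a bounded random variable $X$ is $$E_V[X]=\int_0^{+\infty}V(\{X\ge t\})\,dt+\int_{-\infty}^0\big[V(\{X\ge t\})-1\big]\,dt.$$ For $f:\mathbb R^2\to\mathbb R$, $\mathcal U_f=\{\{(x_1,x_2)\in\mathbb R^2: f(x_1,x_2)>\alpha\}:\alpha\in\mathbb R\}$. $X_1$ and $X_2$ are Fubini independent for $\mathcal U_f$ (i.e. $X_2$ is Fubini independent of $X_1$ for $\mathcal U_f$) if for every $A\in\mathcal U_f$ $$V((X_1,X_2)\in A)=E_V\big[V((x_1,X_2)\in A)|_{x_1=X_1}\big].$$ The notation $h(x_1)|_{x_1=X_1}$ denotes the function $\omega\mapsto h(X_1(\omega))$; here $h(x_1)=V(\{\omega':(x_1,X_2(\omega'))\in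 A\})$, respectively $h(x_1)=E_V[\hat f(x_1,X_2)]$ with $x_1$ held fixed. *)

(* Defs.v *)
From HB Require Import structures.
From mathcomp Require Import all_boot all_order all_algebra.
From mathcomp Require Import all_classical all_reals all_analysis.
Set Implicit Arguments.
Unset Strict Implicit.
Unset Printing Implicit Defensive.
Import Order.TTheory GRing.Theory Num.Theory.
Import numFieldNormedType.Exports.
Local Open Scope classical_set_scope.
Local Open Scope ring_scope.

(* A capacity is a function on all sets of which only the values on measurable
   sets are constrained. *)
Record is_capacity (d : measure_display) (T : measurableType d) (R : realType)
    (V : set T -> R) : Prop := IsCapacity {
  capacity_itv : forall A, measurable A -> 0 <= V A <= 1 ;
  capacity0 : V set0 = 0 ;
  capacityT : V setT = 1 ;
  capacity_le : forall A B,
    measurable A -> measurable B -> A `<=` B -> V A <= V B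
}.

(* Meaningful for a bounded measurable [X]: the integrands are then monotone in
   [t] and vanish for large [|t|], so that both integrals are finite. *)
Definition choquet (d : measure_display) (T : measurableType d) (R : realType)
    (V : set T -> R) (X : T -> R) : R :=
  (\int[lebesgue_measure]_(t in `[0, +oo[) V [set w | t <= X w]) +
  (\int[lebesgue_measure]_(t in `]-oo, 0]) (V [set w | t <= X w] - 1)).

Definition upper_level_sets (R : realType) (f : R * R -> R) : set (set (R * R)) :=
  [set A | exists alpha : R, A = [set x | alpha < f x]].

(* [X2] is Fubini independent of [X1] for the class [U]. *)
Definition fubini_independent (d : measure_display) (T : measurableType d)
    (R : realType) (V : set T -> R) (X1 X2 : T -> R) (U : set (set (R * R))) :
    Prop :=
  forall A, U A ->
    V [set w | A (X1 w, X2 w)] =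
    choquet V (fun w => V [set w' | A (X1 w, X2 w')]).

Definition exp_sum (R : realType) (phi1 phi2 : R -> R) (x : R * R) : R :=
  expR (phi1 x.1 + phi2 x.2).

(* Main.v *)
(* Put Y = exp(phi1(X1)), Z = exp(phi2(X2)), G(s) = V(Z > s), and let q be the
   generalized inverse of G. For fixed a > 0, Fubini independence writes
   V(YZ > a) as the integral over u in ]0, 1] of V(G(a/Y) >= u), and this
   integrand is squeezed between V(Y > a/q(u)) and V(Y >= a/q(u)). Integrating
   in a, exchanging the integrals of the bounds (which, unlike the integrand, are
   clearly jointly measurable) and rescaling a by q(u) gives
   E[YZ] = E[Y] * int q = E[Y] * E[Z]; the right-hand side has the same value by
   positive homogeneity. *)
Require Import Defs.
From HB Require Import structures.
From mathcomp Require Import all_boot all_order all_algebra.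
From mathcomp Require Import all_classical all_reals all_analysis.
From mathcomp Require Import measurable_realfun.
Import Order.TTheory GRing.Theory Num.Theory.
Import numFieldNormedType.Exports.
Local Open Scope classical_set_scope.
Local Open Scope ring_scope.

(** * Scaling of Lebesgue integrals and interlaced monotone functions *)

Lemma lebesgue_measure_scale (R : realType) (c : R) (A : set R) : 0 < c ->
  measurable A ->
  (lebesgue_measure (( *%R c^-1 : R -> measurableTypeR R) @^-1` A) =
   c%:E * lebesgue_measure A)%E.
Proof.
move=> c0 mA.
have mf : measurable_fun [set: measurableTypeR R]
    ( *%R c^-1 : measurableTypeR R -> measurableTypeR R).
  exact: measurable_funM.
have ci0 : 0 <= c^-1 by rewrite invr_ge0 ltW.
(* The measure [c^-1] times the pushforward of Lebesgue measure along multiplication by [c^-1] gives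
   each []a, b]] its length, so by uniqueness it is Lebesgue measure. *)
pose m' : measure (measurableTypeR R) R :=
  mscale (NngNum ci0) (pushforward lebesgue_measure
    ( *%R c^-1 : measurableTypeR R -> measurableTypeR R)).
pose m := m' mf.
rewrite (@lebesgue_measure_unique R m _ A mA); last first.
  move=> _ [[a b]] _ <-; rewrite /m /= /mscale /= /pushforward.
  rewrite (_ : _ @^-1` _ = `]c * a, c * b]%classic); last first.
    apply/seteqP; split => x /=;
    by rewrite !in_itv/= ltr_pdivlMl// ler_pdivrMl.
  rewrite !lebesgue_measure_itv/= !lte_fin ltr_pM2l//.
  case: ifPn => _; last by rewrite mule0.
  by rewrite -!EFinD -EFinM -mulrBr mulKf// gt_eqF.
by rewrite /m/= /mscale/= muleA -EFinM divff ?gt_eqF// mul1e.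
Qed.

Lemma ge0_integral_scale (R : realType) (c : R) (f : R -> R) : 0 < c ->
  measurable_fun [set: R] f -> (forall x, 0 <= f x) ->
  (\int[lebesgue_measure]_(x in `]0%R, +oo[) (f (x / c))%:E =
   c%:E * \int[lebesgue_measure]_(x in `]0%R, +oo[) (f x)%:E)%E.
Proof.
move=> c0 mf f0.
have ms : measurable_fun [set: measurableTypeR R]
    ( *%R c^-1 : measurableTypeR R -> measurableTypeR R).
  exact: measurable_funM.
have mEf : measurable_fun (`]0, +oo[ : set R) (EFin \o f).
  by apply/measurable_EFinP; exact: measurable_funTS.
transitivity (\int[pushforward lebesgue_measure
    ( *%R c^-1 : measurableTypeR R -> measurableTypeR R)]_(x in `]0%R, +oo[)
    (EFin \o f) x)%E.
  rewrite ge0_integral_pushforward//=; last first.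
    by move=> x _; rewrite lee_fin.
  rewrite (_ : _ @^-1` _ = `]0%R, +oo[%classic); last first.
    apply/seteqP; split => x /=;
    by rewrite !in_itv/= !andbT pmulr_rgt0 ?invr_gt0.
  by apply: eq_integral => x _; rewrite mulrC.
rewrite -[c in RHS]/((NngNum (ltW c0))%:num).
rewrite -ge0_integral_mscale//; last by move=> x _; rewrite lee_fin.
by apply: eq_measure_integral => A mA _; exact: lebesgue_measure_scale.
Qed.

(** For [0 < r < 1] and [x > 0], [x < x / r] gives [f (x / r) <= g x]. After rescaling, [r] times
    the integral of [f] is at most the integral of [g], and [r] is arbitrarily close to 1. The
    argument also covers infinite integrals. *)
Lemma eq_integral_nonincreasing (R : realType) (f g : R -> R) :
  nonincreasing_fun f -> nonincreasing_fun g -> (forall x, 0 <= g x) ->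
  (forall x, g x <= f x) -> (forall x y, x < y -> f y <= g x) ->
  (\int[lebesgue_measure]_(x in `]0%R, +oo[) (f x)%:E =
   \int[lebesgue_measure]_(x in `]0%R, +oo[) (g x)%:E)%E.
Proof.
move=> nf ng g0 gf fg.
have f0 x : 0 <= f x by rewrite (le_trans (g0 x)).
have mf : measurable_fun [set: R] f by exact: nonincreasing_measurable.
have mg : measurable_fun [set: R] g by exact: nonincreasing_measurable.
have mEg : measurable_fun (`]0, +oo[ : set R) (EFin \o g).
  by apply/measurable_EFinP; exact: measurable_funTS.
apply/eqP; rewrite eq_le; apply/andP; split; last first.
  apply: ge0_le_integral => //=.
  - by move=> x _; rewrite lee_fin.
  - by apply/measurable_EFinP; exact: measurable_funTS.
  - by move=> x _; rewrite lee_fin.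
apply/lee_mul01Pr => [|r /andP[r0 r1]].
  by apply: integral_ge0 => x _; rewrite lee_fin.
rewrite -ge0_integral_scale//; apply: ge0_le_integral => //=.
- by move=> x _; rewrite lee_fin.
- apply/measurable_EFinP; apply: measurable_funTS.
  by apply: measurableT_comp => //; exact: measurable_funM.
- move=> x; rewrite in_itv/= andbT => x0; rewrite lee_fin fg//.
  by rewrite ltr_pdivlMr// gtr_pMr.
Qed.

(** * Tonelli's theorem on a measurable rectangle *)

Section tonelli.
Context d1 d2 (T1 : measurableType d1) (T2 : measurableType d2) (R : realType).
Variables (m1 : {sigma_finite_measure set T1 -> \bar R}).
Variables (m2 : {sigma_finite_measure set T2 -> \bar R}).
Variables (A : set T1) (B : set T2) (f : T1 * T2 -> \bar R).
Hypotheses (mA : measurable A) (mB : measurable B).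
Hypotheses (mf : measurable_fun setT f) (f0 : forall x, (0 <= f x)%E).

(** Extending [f] by zero outside the rectangle reduces everything to Tonelli on the whole product
    space. *)
Let g := f \_ (A `*` B).

Let mg : measurable_fun setT g.
Proof.
apply/(measurable_restrictT _ (measurableX mA mB)).
exact: measurable_funTS.
Qed.

Let g0 x : (0 <= g x)%E.
Proof. by rewrite /g patchE; case: ifPn. Qed.

Let gE1 x : (\int[m2]_y g (x, y) =
  ((fun x => \int[m2]_(y in B) f (x, y)) \_ A) x)%E.
Proof.
rewrite patchE; case: ifPn => xA.
  rewrite [RHS]integral_mkcond; apply: eq_integral => y _.
  by rewrite /g !patchE in_setX xA.
by apply: integral0_eq => y _; rewrite /g patchE in_setX (negbTE xA).
Qed.

Let gE2 y : (\int[m1]_x g (x, y) =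
  ((fun y => \int[m1]_(x in A) f (x, y)) \_ B) y)%E.
Proof.
rewrite patchE; case: ifPn => yB.
  rewrite [RHS]integral_mkcond; apply: eq_integral => x _.
  by rewrite /g !patchE in_setX yB andbT.
by apply: integral0_eq => x _; rewrite /g patchE in_setX (negbTE yB) andbF.
Qed.

Lemma measurable_fubini_tonelli_in :
  measurable_fun A (fun x => \int[m2]_(y in B) f (x, y))%E.
Proof.
apply/(measurable_restrictT _ mA).
rewrite (_ : _ \_ A = fubini_F m2 g); last by apply/funext => x; rewrite -gE1.
exact: measurable_fun_fubini_tonelli_F.
Qed.

Lemma fubini_tonelli_in :
  (\int[m1]_(x in A) \int[m2]_(y in B) f (x, y) =
   \int[m2]_(y in B) \int[m1]_(x in A) f (x, y))%E.
Proof.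
rewrite integral_mkcond [RHS]integral_mkcond.
under eq_integral do rewrite -gE1.
under [RHS]eq_integral do rewrite -gE2.
exact: fubini_tonelli.
Qed.

End tonelli.

(** * Mixtures of rescaled monotone functions *)

Section mixture.
Context (R : realType) (q : R -> R).
Hypotheses (nq : nonincreasing_fun q) (q0 : forall u, 0 < q u).
Local Notation mu := (@lebesgue_measure R).

Section mixture1.
Variable f : R -> R.
Hypotheses (nf : nonincreasing_fun f) (f0 : forall x, 0 <= f x).

(** Joint measurability comes from monotonicity: [f] and the inverse of [q] are both monotone, hence
    Borel. *)
Let mfq : measurable_fun [set: R * R] (fun z => (f (z.1 / q z.2))%:E).
Proof.
apply/measurable_EFinP; apply: (@measurableT_comp _ _ _ _ _ _ f).
  exact: nonincreasing_measurable.
apply: measurable_funM; first exact: measurable_fst.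
apply: (@measurableT_comp _ _ _ _ _ _ (fun u => (q u)^-1)).
  apply: nondecreasing_measurable => // x y xy.
  by rewrite lef_pV2 ?posrE//; exact: nq.
exact: measurable_snd.
Qed.

Lemma measurable_mixture : measurable_fun (`]0, +oo[ : set R)
  (fun a => \int[mu]_(u in `]0%R, 1%R]) (f (a / q u))%:E)%E.
Proof.
apply: (measurable_fubini_tonelli_in _ _ (measurableTypeR R) _ _ mu _ _
  (fun z : R * R => (f (z.1 / q z.2))%:E)) => //.
by move=> z; rewrite lee_fin.
Qed.

(** Tonelli moves the integral over [a] inside, where rescaling by [q u] brings out the factor
    [q u]. *)
Lemma integral_mixture : (\int[mu]_(a in `]0%R, +oo[)
    \int[mu]_(u in `]0%R, 1%R]) (f (a / q u))%:E =
  \int[mu]_(a in `]0%R, +oo[) (f a)%:E *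
  \int[mu]_(u in `]0%R, 1%R]) (q u)%:E)%E.
Proof.
rewrite (fubini_tonelli_in _ _ _ _ _ mu mu _ _
  (fun z : R * R => (f (z.1 / q z.2))%:E))//=; last first.
  by move=> z; rewrite lee_fin.
rewrite muleC -ge0_integralZr//.
- apply: eq_integral => u _; apply: ge0_integral_scale => //.
  exact: nonincreasing_measurable.
- apply/measurable_EFinP; exact: nonincreasing_measurable.
- by move=> u _; rewrite lee_fin ltW.
- by apply: integral_ge0 => x _; rewrite lee_fin.
Qed.

End mixture1.

(** Each [K a] is measurable in [u] alone, so Tonelli is applied to the two bounds and not to [K].
    The bounds have mixtures of equal integral because [f] and [g] interlace, and [W] is caught
    between these mixtures. *)
Lemma integral_mixture_between (f g W : R -> R) (K : R -> R -> R) :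
  nonincreasing_fun f -> nonincreasing_fun g -> (forall x, 0 <= g x) ->
  (forall x, g x <= f x) -> (forall x y, x < y -> f y <= g x) ->
  (forall a : R, 0 < a -> measurable_fun (`]0, 1] : set R) (K a)) ->
  (forall a u : R, 0 < a -> 0 < u <= 1 ->
    g (a / q u) <= K a u <= f (a / q u)) ->
  measurable_fun (`]0, +oo[ : set R) W ->
  (forall a : R, (0 < a)%R ->
    (W a)%:E = \int[mu]_(u in `]0%R, 1%R]) (K a u)%:E)%E ->
  (\int[mu]_(a in `]0%R, +oo[) (W a)%:E =
   \int[mu]_(a in `]0%R, +oo[) (f a)%:E *
   \int[mu]_(u in `]0%R, 1%R]) (q u)%:E)%E.
Proof.
move=> nf ng g0 gf fg mK Kfg mW WK.
have f0 x : 0 <= f x by rewrite (le_trans (g0 x)).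
have mW' : measurable_fun (`]0, +oo[ : set R) (EFin \o W).
  exact/measurable_EFinP.
have mhq (h : R -> R) a : 0 < a -> nonincreasing_fun h ->
    measurable_fun (`]0, 1] : set R) (fun u : R => (h (a / q u))%:E).
  move=> a0 nh; apply/measurable_EFinP; apply: nonincreasing_measurable => //.
  by move=> x y xy; apply: nh; rewrite ler_pM2l// lef_pV2 ?posrE//; exact: nq.
have W0 a : 0 < a -> (0 <= (W a)%:E)%E.
  move=> a0; rewrite WK//; apply: integral_ge0 => u; rewrite /= in_itv/= => u01.
  by rewrite lee_fin (le_trans (g0 (a / q u)))//; case/andP: (Kfg a u a0 u01).
apply/eqP; rewrite eq_le; apply/andP; split.
  rewrite -integral_mixture//; apply: ge0_le_integral => //.
  - by move=> a; rewrite /= in_itv/= andbT; exact: W0.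
  - exact: measurable_mixture.
  - move=> a; rewrite /= in_itv/= andbT => a0; rewrite WK//.
    apply: ge0_le_integral => //.
    + move=> u; rewrite /= in_itv/= => u01; rewrite lee_fin.
      by rewrite (le_trans (g0 (a / q u)))//; case/andP: (Kfg a u a0 u01).
    + by apply/measurable_EFinP; exact: mK.
    + exact: mhq.
    + by move=> u; rewrite /= in_itv/= lee_fin => /(Kfg a u a0)/andP[].
(* For the lower bound, the integral of [f] is traded for that of [g], whose mixture lies below
   [W]. *)
rewrite (eq_integral_nonincreasing _ _ g)// -integral_mixture//.
apply: ge0_le_integral => //.
- by move=> a _; apply: integral_ge0 => u _; rewrite lee_fin.
- exact: measurable_mixture.
- move=> a; rewrite /= in_itv/= andbT => a0; rewrite WK//.
  apply: ge0_le_integral => //.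
  + by move=> u _; rewrite lee_fin.
  + exact: mhq.
  + by apply/measurable_EFinP; exact: mK.
  + by move=> u; rewrite /= in_itv/= lee_fin => /(Kfg a u a0)/andP[].
Qed.

End mixture.

(** * Generalized inverse of a nonincreasing function *)

Section generalized_inverse.
Context (R : realType) (G : R -> R) (c d : R).
Hypotheses (cd : c <= d) (nG : nonincreasing_fun G).

Let below u := [set s | s <= d /\ (s <= c \/ u <= G s)].

(* The clamping to [[c, d]] keeps this positive and nonincreasing on all of [R],
   not only for the relevant levels [0 < u <= 1]. *)
Definition ginv u := sup (below u).

Let below0 u : below u !=set0.
Proof. by exists c; split=> //; left. Qed.

Let has_ubound_below u : has_ubound (below u).
Proof. by exists d => s []. Qed.

Lemma ginv_ge u : c <= ginv u.
Proof. by apply: ub_le_sup => //; split=> //; left. Qed.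

Lemma ginv_le u : ginv u <= d.
Proof. by apply: ge_sup => // s []. Qed.

Lemma nonincreasing_ginv : nonincreasing_fun ginv.
Proof.
move=> u v uv; apply: ge_sup => // s [sd sG]; apply: ub_le_sup => //.
by split=> //; case: sG => [|vG]; [left|right; exact: le_trans vG].
Qed.

Lemma le_ginv u s : s <= d -> u <= G s -> s <= ginv u.
Proof. by move=> sd uG; apply: ub_le_sup => //; split=> //; right. Qed.

(** Some [t] in [below u] exceeds [s]. If [t] is there by clamping only, then [s < c] and the
    hypothesis applies; otherwise [G] is at least [u] at [t], hence at [s]. The supremum may not be
    attained, so the inequality is strict here and weak in [le_ginv]. *)
Lemma lt_ginv u s : (forall t, t < c -> u <= G t) -> s < ginv u -> u <= G s.
Proof.
move=> Gc /(sup_gt (below0 u))[t [_ tG] st].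
case: tG => [tc|uG]; first by apply: Gc; exact: lt_le_trans tc.
by rewrite (le_trans uG)// nG// ltW.
Qed.

End generalized_inverse.

(** * Survival functions of a capacity and the Choquet integral *)

Section survival.
Context (d : measure_display) (T : measurableType d) (R : realType).
Variable V : set T -> R.
Hypothesis hV : is_capacity V.
Local Notation mu := (@lebesgue_measure R).

Lemma measurable_level_ge (X : T -> R) t : measurable_fun setT X ->
  measurable [set w | t <= X w].
Proof.
move=> mX; rewrite (_ : [set _ | _] = setT `&` X @^-1` `[t, +oo[).
  exact: mX (measurable_itv _).
by apply/seteqP; split => w /=; rewrite in_itv/= andbT => // -[].
Qed.

Lemma measurable_level_gt (X : T -> R) t : measurable_fun setT X ->
  measurable [set w | t < X w].
Proof.
move=> mX; rewrite (_ : [set _ | _] = setT `&` X @^-1` `]t, +oo[).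
  exact: mX (measurable_itv _).
by apply/seteqP; split => w /=; rewrite in_itv/= andbT => // -[].
Qed.

Lemma capacity_ge0 A : measurable A -> 0 <= V A.
Proof. by move=> /(capacity_itv hV)/andP[]. Qed.

Lemma capacity_le1 A : measurable A -> V A <= 1.
Proof. by move=> /(capacity_itv hV)/andP[]. Qed.

Section survival_fun.
Variable X : T -> R.
Hypothesis mX : measurable_fun setT X.

Lemma nonincreasing_capacity_ge :
  nonincreasing_fun (fun t => V [set w | t <= X w]).
Proof.
move=> s t st; apply: (capacity_le hV); try exact: measurable_level_ge.
by move=> w; exact: le_trans.
Qed.

Lemma nonincreasing_capacity_gt :
  nonincreasing_fun (fun t => V [set w | t < X w]).
Proof.
move=> s t st; apply: (capacity_le hV); try exact: measurable_level_gt.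
by move=> w; exact: le_lt_trans.
Qed.

Lemma capacity_gt_le_ge t : V [set w | t < X w] <= V [set w | t <= X w].
Proof.
apply: (capacity_le hV).
- exact: measurable_level_gt.
- exact: measurable_level_ge.
- by move=> w; exact: ltW.
Qed.

Lemma capacity_ge_le_gt s t : s < t ->
  V [set w | t <= X w] <= V [set w | s < X w].
Proof.
move=> st.
apply: (capacity_le hV).
- exact: measurable_level_ge.
- exact: measurable_level_gt.
- by move=> w; exact: lt_le_trans.
Qed.

(** The weak and strict survival functions interlace by monotonicity of [V]. *)
Lemma integral_capacity_ge_gt :
  (\int[mu]_(t in `]0%R, +oo[) (V [set w | (t <= X w)%R])%:E =
   \int[mu]_(t in `]0%R, +oo[) (V [set w | (t < X w)%R])%:E)%E.
Proof.
apply: eq_integral_nonincreasing.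
- exact: nonincreasing_capacity_ge.
- exact: nonincreasing_capacity_gt.
- by move=> t; apply/capacity_ge0/measurable_level_gt.
- exact: capacity_gt_le_ge.
- by move=> s t; exact: capacity_ge_le_gt.
Qed.

(** For [t <= 0] the level set is the whole space, of capacity 1, so the second integral vanishes.
    In the first, the endpoint 0 is a null set. *)
Lemma choquet_ge0E : (forall w, 0 <= X w) ->
  choquet V X =
  fine (\int[mu]_(t in `]0%R, +oo[) (V [set w | (t <= X w)%R])%:E)%E.
Proof.
move=> X0; rewrite /choquet.
rewrite [X in _ + X](_ : _ = 0); last first.
  rewrite /Rintegral integral0_eq// => t; rewrite /= in_itv/= => t0.
  rewrite (_ : [set w | _] = setT) ?(capacityT hV) ?subrr//.
  by apply/seteqP; split => w //= _; exact: le_trans t0 (X0 w).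
rewrite addr0 /Rintegral -integral_itv_obnd_cbnd//; apply/measurable_EFinP.
exact: (nonincreasing_measurable (measurable_itv _) nonincreasing_capacity_ge).
Qed.

End survival_fun.

Lemma choquetZ (a : R) (X : T -> R) : 0 < a -> measurable_fun setT X ->
  (forall w, 0 <= X w) -> choquet V (fun w => a * X w) = a * choquet V X.
Proof.
move=> a0 mX X0; rewrite !choquet_ge0E//; last 2 first.
- exact: measurable_funM.
- by move=> w; rewrite mulr_ge0// ltW.
transitivity (fine (\int[mu]_(t in `]0%R, +oo[)
    (V [set w | (t / a <= X w)%R])%:E)%E).
  congr fine; apply: eq_integral => t _; congr (V _)%:E.
  by apply/seteqP; split => w /=; rewrite ler_pdivrMr// (mulrC a).
rewrite (@ge0_integral_scale R a (fun t => V [set w | t <= X w]))//; last 2 first.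
- by apply: nonincreasing_measurable => //; exact: nonincreasing_capacity_ge.
- by move=> t; apply/capacity_ge0/measurable_level_ge.
(* At infinite values [fine] sends both the integral and its positive multiple to 0, so the identity
   persists. *)
move: (\int[_]_(_ in _) _)%E => [r| |] //=.
- by rewrite gt0_muley ?lte_fin//= mulr0.
- by rewrite gt0_muleNy ?lte_fin//= mulr0.
Qed.

End survival.

(** * Integrals of indicators and finiteness *)

Lemma integral_le_cst (R : realType) (D : set R) (t : R) : measurable D ->
  (\int[lebesgue_measure]_(x in D) ((x <= t)%R%:R)%:E =
   lebesgue_measure (`]-oo, t] `&` D))%E.
Proof.
move=> mD; rewrite -integral_indic//; apply: eq_integral => x _.
by rewrite indicE mem_setE in_itv.
Qed.

(** The bound makes [f] at most 1 and zero beyond [b], so the integral is at most [b]. *)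
Lemma integral_fin_num_of_bound (R : realType) (f : R -> R) (b : R) :
  0 <= b -> nonincreasing_fun f -> (forall x, 0 <= f x <= (x <= b)%R%:R) ->
  (\int[lebesgue_measure]_(x in `]0%R, +oo[) (f x)%:E)%E \is a fin_num.
Proof.
move=> b0 nf fb; rewrite ge0_fin_numE; last first.
  by apply: integral_ge0 => x _; rewrite lee_fin; case/andP: (fb x).
apply: (@le_lt_trans _ _ (\int[lebesgue_measure]_(x in (`]0%R, +oo[ : set R))
    (x <= b)%R%:R%:E)%E).
  apply: ge0_le_integral => //.
  - by move=> x _; rewrite lee_fin; case/andP: (fb x).
  - by apply/measurable_EFinP; exact: nonincreasing_measurable.
  - apply/measurable_EFinP; apply: nonincreasing_measurable => // x y xy.
    by rewrite ler_nat; case: (leP y b) => // yb; rewrite (le_trans xy).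
  - by move=> x _; rewrite lee_fin; case/andP: (fb x).
rewrite integral_le_cst// (_ : _ `&` _ = `]0, b]%classic); last first.
  by apply/seteqP; split => x /=; rewrite !in_itv/= ?andbT;
      [case=> -> ->|case/andP=> -> ->].
rewrite lebesgue_measure_itv/= lte_fin; case: ifP => // _.
by rewrite -EFinD ltry.
Qed.

(** * The product formula under Fubini independence *)

Section fubini_choquet.
Context (d : measure_display) (T : measurableType d) (R : realType).
Variable V : set T -> R.
Hypothesis hV : is_capacity V.
Local Notation mu := (@lebesgue_measure R).

Section bounded_below.
Variables (Z : T -> R) (c b : R).
Hypotheses (mZ : measurable_fun setT Z) (c0 : 0 < c) (cb : c <= b).
Hypotheses (cZ : forall w, c <= Z w) (Zb : forall w, Z w <= b).

Let G t := V [set w | t < Z w].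
Let q := ginv R G c b.

Let nG : nonincreasing_fun G. Proof. exact: nonincreasing_capacity_gt. Qed.

Let mG D : measurable D -> measurable_fun D G.
Proof. by move=> mD; exact: nonincreasing_measurable. Qed.

Let G0 t : 0 <= G t. Proof. exact/capacity_ge0/measurable_level_gt. Qed.

Let G1 t : G t <= 1. Proof. exact/capacity_le1/measurable_level_gt. Qed.

Let G_lt t : t < c -> G t = 1.
Proof.
move=> tc; rewrite -(capacityT hV); congr V.
by apply/seteqP; split=> w //= _; exact: lt_le_trans (cZ w).
Qed.

Let G_ge t : b <= t -> G t = 0.
Proof.
move=> bt; rewrite -(capacity0 hV); congr V.
by apply/seteqP; split=> w //=; rewrite ltNge (le_trans (Zb w)).
Qed.

Let nq : nonincreasing_fun q. Proof. exact: nonincreasing_ginv. Qed.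

Let q0 u : 0 < q u. Proof. exact: lt_le_trans (ginv_ge R G c b cb u). Qed.

(** Clamping does no harm at the levels [0 < u <= 1]: [G] vanishes from [b] on, so [u <= G s] forces
    [s <= b]; and [G] is 1 below [c], as [lt_q] requires. *)
Let le_q u s : 0 < u -> u <= G s -> s <= q u.
Proof.
move=> u0 uG; apply: le_ginv => //; rewrite leNgt; apply/negP => /ltW/G_ge Gs.
by move: uG; rewrite Gs leNgt u0.
Qed.

Let lt_q u s : u <= 1 -> s < q u -> u <= G s.
Proof. by move=> u1; apply: lt_ginv => // t /G_lt ->. Qed.

(** This is the mixture argument for the constant [Y = 1], whose survival functions are the
    indicators of [x <= 1] and [x < 1], with integral 1 over the half line. Here [K a u] indicates
    [u <= G a]. *)
Lemma integral_capacity_gt_ginv :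
  (\int[mu]_(t in `]0%R, +oo[) (V [set w | (t < Z w)%R])%:E =
   \int[mu]_(u in `]0%R, 1%R]) (q u)%:E)%E.
Proof.
rewrite (integral_mixture_between R q nq q0 (fun x => (x <= 1)%R%:R)
  (fun x => (x < 1)%R%:R) G (fun a u => (u <= G a)%R%:R)).
- rewrite integral_le_cst// (_ : _ `&` _ = `]0, 1]%classic); last first.
    by apply/seteqP; split => x /=; rewrite !in_itv/= ?andbT;
      [case=> -> ->|case/andP=> -> ->].
  by rewrite lebesgue_measure_itv/= lte_fin ltr01 -EFinD subr0 mul1e.
- move=> x y xy; rewrite ler_nat.
  by case: (leP y 1) => // y1; rewrite (le_trans xy).
- move=> x y xy; rewrite ler_nat.
  by case: (ltP y 1) => // y1; rewrite (le_lt_trans xy).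
- by [].
- by move=> x; rewrite ler_nat; case: (ltP x 1) => // /ltW ->.
- move=> x y xy; rewrite ler_nat.
  by case: (leP y 1) => // y1; rewrite (lt_le_trans xy).
- move=> a a0; apply: nonincreasing_measurable => // u v uv; rewrite ler_nat.
  by case: (leP v (G a)) => // vG; rewrite (le_trans uv).
- move=> a u a0 /andP[u0 u1]; rewrite !ler_nat.
  rewrite ltr_pdivrMr// ler_pdivrMr// mul1r; apply/andP; split.
    by case: ltP => // aq; rewrite lt_q.
  by case: leP => // uG; rewrite le_q.
- exact: mG.
(* Since [G a <= 1], the levels [u] of []0, 1]] with [u <= G a] fill []0, G a]], of length [G a]. *)
- move=> a a0; rewrite integral_le_cst//.
  rewrite (_ : _ `&` _ = `]0, G a]%classic); last first.
    apply/seteqP; split => x /=; rewrite !in_itv/=; first by case=> -> /andP[->].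
    by move=> /andP[-> xG]; rewrite xG (le_trans xG).
  rewrite lebesgue_measure_itv/= lte_fin; case: ltP => [_|Ga0].
    by rewrite -EFinD subr0.
  by congr EFin; apply/le_anti; rewrite G0 Ga0.
Qed.

Lemma fin_num_integral_capacity_gt :
  (\int[mu]_(t in `]0%R, +oo[) (V [set w | (t < Z w)%R])%:E)%E \is a fin_num.
Proof.
apply: (@integral_fin_num_of_bound R G b) => //.
- by rewrite (le_trans _ cb)// ltW.
- by move=> x; rewrite G0/=; case: (leP x b) => [//|/ltW/G_ge->].
Qed.

(** The integral of [q] over []0, 1]] is at least [c], since [q] is. Positivity allows [choquetZ] to
    pull [choquet V Z] out as a factor. *)
Lemma choquet_gt0 : 0 < choquet V Z.
Proof.
have Z0 w : 0 <= Z w by rewrite (le_trans _ (cZ w))// ltW.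
rewrite choquet_ge0E// integral_capacity_ge_gt//.
rewrite fine_gt0// ltey_eq fin_num_integral_capacity_gt/= andbT.
rewrite integral_capacity_gt_ginv.
apply: (@lt_le_trans _ _ (\int[mu]_(u in (`]0%R, 1%R] : set R)) (cst c%:E) u)%E).
  rewrite integral_cst//= lebesgue_measure_itv/= lte_fin ltr01 -EFinD subr0.
  by rewrite mule1 lte_fin.
apply: ge0_le_integral => //.
- by move=> u _; rewrite lee_fin ltW.
- by apply/measurable_EFinP; exact: nonincreasing_measurable.
- by move=> u _; rewrite lee_fin ginv_ge.
Qed.

Lemma integral_capacity_mul (Y : T -> R) :
  measurable_fun setT Y -> (forall w, 0 < Y w) ->
  (forall a, 0 < a -> V [set w | a < Y w * Z w] =
    choquet V (fun w => V [set w' | a < Y w * Z w'])) ->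
  (\int[mu]_(t in `]0%R, +oo[) (V [set w | (t <= Y w * Z w)%R])%:E =
   \int[mu]_(t in `]0%R, +oo[) (V [set w | (t <= Y w)%R])%:E *
   \int[mu]_(t in `]0%R, +oo[) (V [set w | (t < Z w)%R])%:E)%E.
Proof.
move=> mY Y0 ind.
have mYZ : measurable_fun setT (fun w => Y w * Z w) by exact: measurable_funM.
have mGY a : 0 < a -> measurable_fun setT (fun w => G (a / Y w)).
  (* Setting the value 0 for [y <= 0] makes [h] nondecreasing on all of [R], hence Borel. *)
  move=> a0; pose h y := if 0 < y then G (a / y) else 0.
  rewrite (_ : (fun w => _) = h \o Y); last first.
    by apply/funext => w; rewrite /h/= Y0.
  apply: measurableT_comp => //; apply: nondecreasing_measurable => // x y xy.
  rewrite /h; case: (ltP 0 x) => x0; last by case: ifP.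
  have y0 := lt_le_trans x0 xy; rewrite y0; apply: nG.
  by rewrite ler_pM2l// lef_pV2 ?posrE.
(* Independence speaks of strict level sets, so the survival function of the product is put in
   strict form. *)
rewrite integral_capacity_ge_gt// integral_capacity_gt_ginv.
apply: (integral_mixture_between R q nq q0 _
  (fun s => V [set w | s < Y w]) _ (fun a u => V [set w | u <= G (a / Y w)])).
- exact: nonincreasing_capacity_ge.
- exact: nonincreasing_capacity_gt.
- by move=> s; exact/capacity_ge0/measurable_level_gt.
- by move=> s; exact: capacity_gt_le_ge.
- by move=> s t; exact: capacity_ge_le_gt.
- move=> a a0; apply: nonincreasing_measurable => //.
  by apply: nonincreasing_capacity_ge => //; exact: mGY.
(* By [lt_q], [a / q u < Y w] implies [u <= G (a / Y w)], which by [le_q] implies [a / q u <= Y w];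
   [V] is monotone along these inclusions. *)
- move=> a u a0 /andP[u0 u1]; apply/andP; split; apply: (capacity_le hV).
  + exact: measurable_level_gt.
  + by apply: measurable_level_ge; exact: mGY.
  + move=> w /=; rewrite ltr_pdivrMr// mulrC => aq.
    by apply: lt_q => //; rewrite ltr_pdivrMr.
  + by apply: measurable_level_ge; exact: mGY.
  + exact: measurable_level_ge.
  + by move=> w /= /(le_q _ _ u0); rewrite ler_pdivrMr// mulrC -ler_pdivrMr.
- by apply: nonincreasing_measurable => //; exact: nonincreasing_capacity_gt.
- move=> a a0; rewrite ind//.
  rewrite (_ : (fun w => V _) = fun w => G (a / Y w)); last first.
    apply/funext => w; congr V; apply/seteqP.
    by split => w' /=; rewrite ltr_pdivrMr// mulrC.
  rewrite (choquet_ge0E _ _ _ _ hV _ (mGY a a0))//.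
  (* As [G <= 1], the level sets above 1 are empty, which cuts the Choquet integral down from []0,
     +oo[] to []0, 1]]. *)
  have K1 u : 1 < u -> V [set w | u <= G (a / Y w)] = 0.
    move=> u1; rewrite -(capacity0 hV); congr V; apply/seteqP.
    by split => w //=; rewrite leNgt (le_lt_trans (G1 _)).
  have nK : nonincreasing_fun (fun u => V [set w | u <= G (a / Y w)]).
    by apply: nonincreasing_capacity_ge => //; exact: mGY.
  have K0 u : 0 <= V [set w | u <= G (a / Y w)].
    by apply/capacity_ge0/measurable_level_ge/mGY.
  rewrite fineK; last first.
    apply: (@integral_fin_num_of_bound R _ 1) => // u; rewrite K0/=.
    by case: (leP u 1) => [_|/K1 ->//];
      apply/capacity_le1/measurable_level_ge/mGY.
  have -> : `]0, +oo[%classic = `]0, 1]%classic `|` `]1, +oo[%classic :> set R.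
    by rewrite -itv_bndbnd_setU// !bnd_simp.
  rewrite ge0_integral_setU//=.
  + rewrite [X in (_ + X)%E]integral0_eq ?adde0// => u.
    by rewrite /= in_itv/= andbT => /K1 ->.
  + apply/measurable_EFinP; apply: nonincreasing_measurable => //.
    exact: measurableU.
  + by move=> u _; rewrite lee_fin.
  + apply/disj_setPLR => u /=; rewrite !in_itv/= andbT => /andP[_ u1].
    by apply/negP; rewrite -leNgt.
Qed.

End bounded_below.

End fubini_choquet.

(** * Reduction of the theorem to the product formula *)

Lemma bounded_fun_expR (R : realType) (phi : R -> R) : bounded_fun phi ->
  exists c b : R, [/\ 0 < c, c <= b & forall x, c <= expR (phi x) <= b].
Proof.
move=> [M [Mreal hM]].
(* [bounded_fun] provides bounds only strictly above [M]. The choice [|M| + 1] is such a bound and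
   is nonnegative, which orders the two exponents. *)
have {}hM x : `|phi x| <= `|M| + 1.
  by apply: hM => //; rewrite (le_lt_trans (ler_norm _))// ltrDl.
exists (expR (- (`|M| + 1))), (expR (`|M| + 1)); split.
- exact: expR_gt0.
- by rewrite ler_expR; apply: le_trans (ge0_cp _).1 _.
- by move=> x; rewrite !ler_expR; rewrite -ler_norml.
Qed.

Theorem theorem3p2 (d : measure_display) (T : measurableType d) (R : realType)
    (V : set T -> R) (hV : is_capacity V)
    (phi1 phi2 : R -> R)
    (mphi1 : measurable_fun setT phi1) (mphi2 : measurable_fun setT phi2)
    (bphi1 : bounded_fun phi1) (bphi2 : bounded_fun phi2)
    (X1 X2 : {mfun T >-> R})
    (hX : fubini_independent V X1 X2 (upper_level_sets (exp_sum phi1 phi2))) :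
  choquet V (fun w => exp_sum phi1 phi2 (X1 w, X2 w)) =
  choquet V (fun w => choquet V (fun w' => exp_sum phi1 phi2 (X1 w, X2 w'))).
Proof.
have [c1 [b1 [c10 cb1 Yb]]] := bounded_fun_expR _ _ bphi1.
have [c2 [b2 [c20 cb2 Zb]]] := bounded_fun_expR _ _ bphi2.
pose Y w := expR (phi1 (X1 w)); pose Z w := expR (phi2 (X2 w)).
have fE w w' : exp_sum phi1 phi2 (X1 w, X2 w') = Y w * Z w' by exact: expRD.
have mY : measurable_fun setT Y.
  apply: (@measurableT_comp _ _ _ _ _ _ expR) => //.
  exact: (@measurableT_comp _ _ _ _ _ _ phi1).
have mZ : measurable_fun setT Z.
  apply: (@measurableT_comp _ _ _ _ _ _ expR) => //.
  exact: (@measurableT_comp _ _ _ _ _ _ phi2).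
have Y0 w : 0 < Y w by exact: expR_gt0.
have Z0 w : 0 < Z w by exact: expR_gt0.
have cY w : c1 <= Y w by case/andP: (Yb (X1 w)).
have bY w : Y w <= b1 by case/andP: (Yb (X1 w)).
have cZ w : c2 <= Z w by case/andP: (Zb (X2 w)).
have bZ w : Z w <= b2 by case/andP: (Zb (X2 w)).
have eZ0 : 0 < choquet V Z by exact: (choquet_gt0 _ _ _ _ hV _ c2 b2).
have ind a : 0 < a -> V [set w | a < Y w * Z w] =
    choquet V (fun w => V [set w' | a < Y w * Z w']).
  move=> a0; have /= := hX [set x | a < exp_sum phi1 phi2 x]
    (ex_intro _ a erefl).
  under eq_set do rewrite fE; move=> ->.
  by congr choquet; apply/funext => w; under eq_set do rewrite fE.
have -> : (fun w => exp_sum phi1 phi2 (X1 w, X2 w)) = fun w => Y w * Z w.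
  by apply/funext => w; rewrite fE.
(* With [w] fixed, [Y w] is a positive constant and leaves the inner Choquet integral. *)
have -> : (fun w => choquet V (fun w' => exp_sum phi1 phi2 (X1 w, X2 w'))) =
    fun w => choquet V Z * Y w.
  apply/funext => w; rewrite [RHS]mulrC -choquetZ// => [|w']; last exact: ltW.
  by congr choquet; apply/funext => w'; rewrite fE.
rewrite choquetZ// => [|w]; last exact: ltW.
have mYZ : measurable_fun setT (fun w => Y w * Z w) by exact: measurable_funM.
rewrite (choquet_ge0E _ _ _ _ hV _ mYZ) => [|w]; last by rewrite mulr_ge0// ltW.
rewrite (choquet_ge0E _ _ _ _ hV _ mY) => [|w]; last exact: ltW.
rewrite (choquet_ge0E _ _ _ _ hV _ mZ) => [|w]; last exact: ltW.
rewrite (integral_capacity_mul _ _ _ _ hV _ c2 b2)//.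
(* Finiteness is established for strict survival functions; it is what makes [fine] multiplicative
   below. *)
rewrite (integral_capacity_ge_gt _ _ _ _ _ Y)//.
rewrite (integral_capacity_ge_gt _ _ _ _ _ Z)//.
rewrite [RHS]mulrC fineM//.
- exact: (fin_num_integral_capacity_gt _ _ _ _ hV _ c1 b1).
- exact: (fin_num_integral_capacity_gt _ _ _ _ hV _ c2 b2).
Qed.
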